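(* The theory $T^*_{\mathrm{feq}2}$ is dfs-trivial: every global Keisler measure (in any tuple of variables) which is dfs is trivial.
   Context: $T^*_{\mathrm{feq}2}$ is in a two-sorted language with sorts $O$ and $P$ and a ternary relation $E_z(x,y)$ on $O_x\times O_y\times P_z$; it is the model completion of the theory asserting that for each $z\in P$, $E_z$ is an equivalence relation on $O$ all of whose classes have size $2$. Work in a monster model $\mathcal{U}$. A global Keisler measure $\mu$ in $x$ is a finitely additive probability measure on $\mathcal{L}_{\mathcal{U}}$-formulas in $x$. $\mu$ is trivial if $\mu=\sum_{n=0}^\infty r_n\delta_{a_n}$ with $a_n\in\mathcal{U}^x$, $r_n\in[0,1]$, $\sum r_n=1$. $\mu$ is dfs if there is a small model $M\prec\mathcal{U}$ such that (i) $\mu$ is definable over $M$: $\mu$ is $M$-invariant ($\mu(\phi(x,b))=\mu(\phi(x,b'))$ whenever $b\equiv_M b'$) and for every $\mathcal{L}$-formula $\phi(x,y)$ the map $S_y(M)\to[0,1]$, $\operatorname{tp}(b/M)\mapsto\mu(\phi(x,b))$, is continuous; and (ii) $\mu$ is finitely satisfiable in $M$: every $\mathcal{L}_{\mathcal{U}}$-formula of positive measure is realized in $M$. *)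

(* Defs.v *)
From HB Require Import structures.
From mathcomp Require Import all_boot all_order all_algebra.
From mathcomp Require Import all_classical all_reals all_analysis.

Set Implicit Arguments.
Unset Strict Implicit.
Unset Printing Implicit Defensive.

Import Order.TTheory GRing.Theory Num.Theory.
Import numFieldNormedType.Exports.

Local Open Scope card_scope.
Local Open Scope classical_set_scope.
Local Open Scope ring_scope.

(* Many-sorted first-order logic in relational languages.  A context of free  *)
(* variables is a sort-indexed family V : lsort L -> Type, and formula V is   *)
(* the type of L-formulas with free variables among V.  A structure is itself *)
(* such a family, so that L_M-sentences are elements of formula M, and        *)
(* formula (sum_fam V M) is the type of L_M-formulas in the variables V.      *)

Record language := Language {
  lsort : Type;
  lrel : Type;
  arity : lrel -> seq lsort }.

Notation family L := (lsort L -> Type).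

Definition empty_fam (L : language) : family L := fun=> Empty_set.
Arguments empty_fam L _ : clear implicits.

Definition sum_fam (L : language) (V W : family L) : family L :=
  fun s => (V s + W s)%type.

(* V together with one further variable of sort s *)
Inductive ext (L : language) (V : family L) (s : lsort L) : family L :=
| Old t : V t -> ext V s t
| New : ext V s s.
Arguments Old {L V s t}.
Arguments New {L V s}.

(* the finite tuple of variables (x_0, ..., x_{n-1}) with x_i of sort sigma i *)
Inductive tvar (L : language) (n : nat) (sigma : 'I_n -> lsort L) : family L :=
| TVar i : tvar sigma (sigma i).

Definition smap (L : language) (V W : family L) := forall s, V s -> W s.

Definition copair (L : language) (V W M : family L)
    (e : smap V M) (f : smap W M) : smap (sum_fam V W) M :=
  fun s v => match v with inl x => e s x | inr y => f s y end.

Definition ext_asg (L : language) (V M : family L) (s : lsort L)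
    (e : smap V M) (a : M s) : smap (ext V s) M :=
  fun t v => match v in ext _ _ t return (M t : Type) with
             | Old t x => e t x
             | New => a
             end.

Definition lift_smap (L : language) (V W : family L) (f : smap V W)
    (s : lsort L) : smap (ext V s) (ext W s) :=
  ext_asg (fun t x => Old (f t x)) New.
Arguments lift_smap {L V W} f s.

Fixpoint args (L : language) (V : family L) (ss : seq (lsort L)) : Type :=
  if ss is s :: ss' then (V s * args V ss')%type else unit.

Fixpoint map_args (L : language) (V W : family L) (f : smap V W)
    (ss : seq (lsort L)) : args V ss -> args W ss :=
  match ss with
  | [::] => id
  | s :: ss' => fun a => (f s a.1, map_args f a.2)
  end.

Inductive formula (L : language) (V : family L) : Type :=
| fbot
| feq s (x y : V s)
| frel (r : lrel L) (a : args V (arity r))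
| fimp (p q : formula V)
| fall s (p : formula (ext V s)).
Arguments fbot {L V}.
Arguments feq {L V s}.
Arguments frel {L V}.
Arguments fimp {L V}.
Arguments fall {L V}.

Definition fnot (L : language) (V : family L) (p : formula V) := fimp p fbot.
Definition ftop (L : language) (V : family L) : formula V := fnot fbot.
Definition fand (L : language) (V : family L) (p q : formula V) :=
  fnot (fimp p (fnot q)).
Definition for_ (L : language) (V : family L) (p q : formula V) :=
  fimp (fnot p) q.
Definition fex (L : language) (V : family L) (s : lsort L)
    (p : formula (ext V s)) := fnot (fall s (fnot p)).
Arguments ftop {L V}.
Arguments fex {L V}.

Fixpoint rename (L : language) (V W : family L) (f : smap V W)
    (p : formula V) {struct p} : formula W :=
  match p with
  | fbot => fbot
  | feq s x y => feq (f s x) (f s y)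
  | frel r a => frel r (map_args f a)
  | fimp p q => fimp (rename f p) (rename f q)
  | fall s p => fall s (rename (lift_smap f s) p)
  end.

Record structure (L : language) := Structure {
  carrier :> family L;
  interp : forall r : lrel L, args carrier (arity r) -> Prop;
  carrier_inhabited : forall s, inhabited (carrier s) }.

Fixpoint sat (L : language) (M : structure L) (V : family L) (p : formula V)
    (e : smap V M) {struct p} : Prop :=
  match p return smap _ M -> Prop with
  | fbot => fun=> False
  | feq s x y => fun e => e s x = e s y
  | frel r a => fun e => interp (map_args e a)
  | fimp p q => fun e => sat p e -> sat q e
  | fall s p => fun e => forall a : M s, sat p (ext_asg e a)
  end e.

Definition fid (L : language) (V : family L) : smap V V := fun=> id.
Arguments fid {L} V.
Definition fcomp (L : language) (V W Z : family L)
  (g : smap W Z) (f : smap V W) : smap V Z := fun s x => g s (f s x).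
Definition fempty (L : language) (V : family L) : smap (empty_fam L) V :=
  fun s x => match x with end.

Definition theory (L : language) := set (formula (empty_fam L)).

Definition models (L : language) (M : structure L) (T : theory L) :=
  forall p, T p -> sat p (fempty M).

Definition embedding (L : language) (M N : structure L) (f : smap M N) :=
  (forall s, injective (f s)) /\
  (forall r (a : args M (arity r)), interp (map_args f a) <-> interp a).

Definition automorphism (L : language) (M : structure L) (f : smap M M) :=
  embedding f /\ forall s, bijective (f s).

Definition elementary (L : language) (M N : structure L) (f : smap M N) :=
  forall p : formula M, sat p (fid M) <-> sat p f.

Definition model_complete (L : language) (T : theory L) :=
  forall (M N : structure L) (f : smap M N),
    models M T -> models N T -> embedding f -> elementary f.

Definition embeds_in_models (L : language) (T T' : theory L) :=
  forall M : structure L, models M T ->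
    exists (N : structure L) (f : smap M N), models N T' /\ embedding f.

Definition model_companion (L : language) (T T' : theory L) :=
  [/\ embeds_in_models T T', embeds_in_models T' T & model_complete T'].

(* The second clause says that T' together with the quantifier-free diagram   *)
(* of M is complete for every model M of T: a model of that theory is a model *)
(* of T' with an embedding of M, and its L_M-theory does not depend on it.    *)
Definition model_completion (L : language) (T T' : theory L) :=
  model_companion T T' /\
  forall (M N N' : structure L) (f : smap M N) (f' : smap M N'),
    models M T -> models N T' -> models N' T' ->
    embedding f -> embedding f' ->
    forall p : formula M, sat p f <-> sat p f'.

Definition subsets (L : language) (U : structure L) := forall s, set (U s).

Definition sub_fam (L : language) (U : structure L) (A : subsets U)
  : family L :=
  fun s => {a : U s | A s a}.

Definition incl (L : language) (U : structure L) (A : subsets U)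
  : smap (sub_fam A) U := fun s => sval.
Arguments incl {L U} A.

Lemma sub_fam_inhabited (L : language) (U : structure L) (A : subsets U) :
  (forall s, A s !=set0) -> forall s, inhabited (sub_fam A s).
Proof.
by move=> A0 s; have [a Aa] := A0 s; exact: inhabits (exist _ a Aa).
Qed.

Definition substructure (L : language) (U : structure L) (A : subsets U)
    (A0 : forall s, A s !=set0) : structure L :=
  @Structure L (sub_fam A) (fun r a => interp (map_args (incl A) a))
    (sub_fam_inhabited A0).

Definition elementary_substructure (L : language) (U : structure L)
    (A : subsets U) :=
  exists A0 : forall s, A s !=set0,
    @elementary L (substructure A0) U (incl A).

(* The cardinal kappa is given as the cardinality of a type K. *)
Definition card_lt (X Y : Type) (A : set X) (B : set Y) : Prop :=
  (A #<= B) /\ ~ (B #<= A).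

Definition small (K : Type) (L : language) (U : structure L) (A : subsets U) :=
  card_lt [set u : {s & U s} | A (projT1 u) (projT2 u)] [set: K].

Definition finitely_sat (L : language) (U : structure L) (V : family L)
    (A : subsets U) (p : set (formula (sum_fam V (sub_fam A)))) :=
  forall (k : nat) (phi : 'I_k -> formula (sum_fam V (sub_fam A))),
    (forall i, p (phi i)) ->
    exists a : smap V U, forall i, sat (phi i) (copair a (incl A)).

Definition saturated (K : Type) (L : language) (U : structure L) :=
  forall (n : nat) (sigma : 'I_n -> lsort L) (A : subsets U)
    (p : set (formula (sum_fam (tvar sigma) (sub_fam A)))),
    small K A -> finitely_sat p ->
    exists a : smap (tvar sigma) U,
      forall phi, p phi -> sat phi (copair a (incl A)).

Definition strongly_homogeneous (K : Type) (L : language) (U : structure L) :=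
  forall (A : subsets U) (f : smap (sub_fam A) U),
    small K A ->
    (forall p : formula (sub_fam A), sat p (incl A) <-> sat p f) ->
    exists g : smap U U, automorphism g /\
      forall s (a : sub_fam A s), g s (sval a) = f s a.

Definition monster (K : Type) (L : language) (T : theory L) (U : structure L) :=
  [/\ card_lt [set: formula (empty_fam L)] [set: K],
      models U T, saturated K U & strongly_homogeneous K U].

(* complete types over A in the variables V; finite satisfiability in U makes *)
(* them consistent with the elementary diagram of U                           *)
Record ctype (L : language) (U : structure L) (A : subsets U) (V : family L) :=
  CType {
    ctype_mem : set (formula (sum_fam V (sub_fam A)));
    ctype_sat : finitely_sat ctype_mem;
    ctype_complete : forall phi, ctype_mem phi \/ ctype_mem (fnot phi) }.

HB.instance Definition _ (L : language) (U : structure L) (A : subsets U)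
  (V : family L) := gen_eqMixin (ctype A V).
HB.instance Definition _ (L : language) (U : structure L) (A : subsets U)
  (V : family L) := gen_choiceMixin (ctype A V).

Definition basic_clopen (L : language) (U : structure L) (A : subsets U)
    (V : family L) (phi : formula (sum_fam V (sub_fam A))) : set (ctype A V) :=
  [set p | ctype_mem p phi].

HB.instance Definition _ (L : language) (U : structure L) (A : subsets U)
  (V : family L) :=
  @isSubBaseTopological.Build (ctype A V) (set (ctype A V))
    (range (@basic_clopen L U A V)) id.

Section TypeOf.
Variables (L : language) (U : structure L) (A : subsets U) (V : family L).
Variable b : smap V U.

Let tp_mem : set (formula (sum_fam V (sub_fam A))) :=
  [set phi | sat phi (copair b (incl A))].

Fact tp_sat : finitely_sat tp_mem.
Proof. by move=> k phi phib; exists b. Qed.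

Fact tp_complete phi : tp_mem phi \/ tp_mem (fnot phi).
Proof. exact: EM. Qed.

Definition tp : ctype A V := CType tp_sat tp_complete.

End TypeOf.
Arguments tp {L U} A {V}.

(* the L_U-formula phi(x, b) *)
Definition inst (L : language) (U : structure L) (V W : family L)
    (phi : formula (sum_fam V W)) (b : smap W U) : formula (sum_fam V U) :=
  rename (fun s v => match v with inl x => inl x | inr y => inr (b s y) end)
    phi.

Definition realizes (L : language) (U : structure L) (V : family L)
    (a : smap V U) (phi : formula (sum_fam V U)) :=
  sat phi (copair a (fid U)).

Record keisler_measure (R : realType) (L : language) (U : structure L)
    (V : family L) := KeislerMeasure {
  kmeas :> formula (sum_fam V U) -> R;
  kmeas_ge0 : forall phi, 0 <= kmeas phi;
  kmeas_equiv : forall phi psi,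
    (forall a : smap V U, realizes a phi <-> realizes a psi) ->
    kmeas phi = kmeas psi;
  kmeas_top : kmeas ftop = 1;
  kmeas_add : forall phi psi,
    (forall a : smap V U, ~ (realizes a phi /\ realizes a psi)) ->
    kmeas (for_ phi psi) = kmeas phi + kmeas psi }.

Definition dirac_kmeas (R : realType) (L : language) (U : structure L)
    (V : family L) (a : smap V U) (phi : formula (sum_fam V U)) : R :=
  (`[< realizes a phi >])%:R.

Definition trivial_kmeas (R : realType) (L : language) (U : structure L)
    (V : family L) (mu : keisler_measure R U V) :=
  exists (r : nat -> R) (a : nat -> smap V U),
    [/\ forall n, 0 <= r n <= 1,
        series r @ \oo --> (1 : R) &
        forall phi,
          series (fun n => r n * dirac_kmeas R (a n) phi) @ \oo --> mu phi].

Definition invariant_over (R : realType) (L : language) (U : structure L)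
    (V : family L) (A : subsets U) (mu : keisler_measure R U V) :=
  forall (m : nat) (tau : 'I_m -> lsort L)
    (phi : formula (sum_fam V (tvar tau)))
    (b b' : smap (tvar tau) U),
    tp A b = tp A b' -> mu (inst phi b) = mu (inst phi b').

Definition definable_over (R : realType) (L : language) (U : structure L)
    (V : family L) (A : subsets U) (mu : keisler_measure R U V) :=
  invariant_over A mu /\
  forall (m : nat) (tau : 'I_m -> lsort L)
    (phi : formula (sum_fam V (tvar tau))),
    exists F : ctype A (tvar tau) -> R,
      continuous F /\ forall b, F (tp A b) = mu (inst phi b).

Definition finitely_satisfiable_in (R : realType) (L : language)
    (U : structure L) (V : family L) (A : subsets U)
    (mu : keisler_measure R U V) :=
  forall phi : formula (sum_fam V U), 0 < mu phi ->
    exists a : smap V (sub_fam A), realizes (fcomp (incl A) a) phi.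

Definition dfs (K : Type) (R : realType) (L : language) (U : structure L)
    (V : family L) (mu : keisler_measure R U V) :=
  exists A : subsets U,
    [/\ elementary_substructure A, small K A,
        definable_over A mu & finitely_satisfiable_in A mu].

Definition dfs_trivial (R : realType) (L : language) (T : theory L) :=
  forall (K : Type) (U : structure L), monster K T U ->
  forall (n : nat) (sigma : 'I_n -> lsort L)
    (mu : keisler_measure R U (tvar sigma)),
    dfs K mu -> trivial_kmeas mu.

Inductive feq_sort := sO | sP.
Inductive feq_rel := rE.

Definition feq_lang : language :=
  @Language feq_sort feq_rel (fun=> [:: sO; sO; sP]).

Definition fE (V : family feq_lang) (z : V sP) (x y : V sO) : formula V :=
  @frel feq_lang V rE (x, (y, (z, tt))).

(* v0 is the variable bound by the innermost quantifier *)
Local Notation v0 := New.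
Local Notation v1 := (Old v0).
Local Notation v2 := (Old v1).
Local Notation v3 := (Old v2).
Local Notation "'AllO' p" := (@fall feq_lang _ sO p) (at level 200).
Local Notation "'AllP' p" := (@fall feq_lang _ sP p) (at level 200).
Local Notation "'ExO' p" := (@fex feq_lang _ sO p) (at level 200).

Definition feq2_refl : formula (empty_fam feq_lang) :=
  AllP AllO fE v1 v0 v0.

Definition feq2_sym : formula (empty_fam feq_lang) :=
  AllP AllO AllO fimp (fE v2 v1 v0) (fE v2 v0 v1).

Definition feq2_trans : formula (empty_fam feq_lang) :=
  AllP AllO AllO AllO
    fimp (fE v3 v2 v1) (fimp (fE v3 v1 v0) (fE v3 v2 v0)).

Definition feq2_size2 : formula (empty_fam feq_lang) :=
  AllP AllO ExO
    fand (fnot (feq v0 v1))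
      (fand (fE v2 v1 v0)
        (AllO fimp (fE v3 v2 v0) (for_ (feq v0 v2) (feq v0 v1)))).

Definition Tfeq2 : theory feq_lang :=
  [set p | p = feq2_refl \/ p = feq2_sym \/ p = feq2_trans \/ p = feq2_size2].

Definition interpE (M : structure feq_lang) (z : M sP) (x y : M sO) : Prop :=
  @interp feq_lang M rE (x, (y, (z, tt))).

Lemma models_Tfeq2 (M : structure feq_lang) :
  models M Tfeq2 <->
  forall z : M sP,
    [/\ forall x, interpE z x x,
        forall x y, interpE z x y -> interpE z y x,
        forall x y w, interpE z x y -> interpE z y w -> interpE z x w &
        forall x, exists y, y <> x /\
          forall w, interpE z x w <-> w = x \/ w = y].
Proof.
split=> [MT z|MT p].
  have Mr := MT _ (or_introl erefl).
  have Ms := MT _ (or_intror (or_introl erefl)).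
  have Mt := MT _ (or_intror (or_intror (or_introl erefl))).
  have M2 := MT _ (or_intror (or_intror (or_intror erefl))).
  split; [exact: Mr | exact: Ms | exact: Mt |] => x.
  apply: contrapT => nex; apply: (M2 z x) => y /= H; apply: H => yx H.
  apply: H => Exy Hw; apply: nex; exists y; split=> // w.
  split=> [Exw|[->|->]]; [| exact: Mr | exact: Exy].
  by have [->|wx] := pselect (w = x); [left | right; apply: Hw].
case=> [->|[->|[->|->]]].
- by move=> z x; have [+ _ _ _] := MT z; apply.
- by move=> z x y; have [_ + _ _] := MT z; apply.
- by move=> z x y w; have [_ _ + _] := MT z; apply.
- move=> z x /= H; have [_ _ _ /(_ x)[y [yx Hy]]] := MT z.
  apply: (H y) => /(_ yx); apply => /(_ (proj2 (Hy y) (or_intror erefl))).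
  by apply=> w Exw wx; case: (proj1 (Hy w) Exw).
Qed.

(* Main.v *)
Require Import Defs.
From mathcomp Require Import all_boot all_order all_algebra.
From mathcomp Require Import all_classical all_reals all_analysis.
From mathcomp Require finmap.
Import Defs.

(* Fix an element c of sort P in the small model A, and say that z in P agrees *)
(* with c at x in O if the E_z-class and the E_c-class of x coincide.  For a  *)
(* coordinate x of the tuple, take a parameter y of the other sort and let    *)
(* phi(x, y) say that x or y (the one of sort P) agrees with c at the other.  *)
(* If phi(a, y) holds for all a in A, then phi(x, y) has measure 1 by finite  *)
(* satisfiability, so by definability and compactness there are, for each     *)
(* e > 0, finitely many a_i in A such that phi(x, y) has measure > 1 - e as   *)
(* soon as all phi(a_i, y) hold.  By genericity some such y has only finitely *)
(* many solutions of phi(x, y) in A, so by finite satisfiability again the    *)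
(* measure of x concentrates, up to e, on a finite set.  Doing this for every *)
(* coordinate gives finite sets of tuples of measure close to 1.              *)

Set Implicit Arguments.
Unset Strict Implicit.
Unset Printing Implicit Defensive.

Import Order.TTheory GRing.Theory Num.Theory.
Import numFieldNormedType.Exports.

Local Open Scope classical_set_scope.
Local Open Scope ring_scope.

(** Two facts about agreement pull against each other. By definability and compactness, finitely
    many agreements of [y] with points of the small model already force its agreement set to have
    measure near 1 ([finitely_many_agreements]). But the theory is so free that finitely many
    agreements can be met by a [y] with only finitely many agreements in the small model
    ([saturated_sagree]). A set without points in that model is null, so each coordinate is
    concentrated on a finite set up to any error ([coordinate_concentrated]). The freeness comes
    from explicit extensions of models of [Tfeq2] ([extend_agree_O], [extend_agree_P]); embedding
    these in models of the completion makes them elementary over the monster. The finite boxes of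
    tuples so obtained, for errors tending to 0, have countable union, so the measure is a countable
    sum of point masses ([trivial_kmeas_enum]). *)

(** * Renaming and satisfaction of derived connectives *)

Lemma smapP (L : language) (V W : family L) (f g : smap V W) :
  (forall s x, f s x = g s x) -> f = g.
Proof. by move=> fg; apply/functional_extensionality_dep => s; apply/funext. Qed.

Lemma map_args_comp (L : language) (V W Z : family L) (f : smap V W)
    (g : smap W Z) ss (a : args V ss) :
  map_args g (map_args f a) = map_args (fcomp g f) a.
Proof. by elim: ss a => //= s ss IH [x a] /=; rewrite IH. Qed.

Lemma sat_rename (L : language) (M : structure L) (V W : family L)
    (f : smap V W) (p : formula V) (e : smap W M) :
  sat (rename f p) e <-> sat p (fcomp e f).
Proof.
elim: p W f e => {V} [V|V s x y|V r a|V p IHp q IHq|V s p IHp] W f e //=.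
- by rewrite map_args_comp.
- by rewrite IHp IHq.
- suff E a : fcomp (ext_asg e a) (lift_smap f s) = ext_asg (fcomp e f) a.
    by split=> H a; [have := H a; rewrite IHp E | rewrite IHp E].
  by apply: smapP => t [].
Qed.

Section connectives.
Variables (L : language) (M : structure L) (V : family L).
Implicit Types (p q : formula V) (e : smap V M).

Lemma sat_fnot p e : sat (fnot p) e <-> ~ sat p e.
Proof. by []. Qed.

Lemma sat_ftop e : sat ftop e.
Proof. by []. Qed.

Lemma sat_fand p q e : sat (fand p q) e <-> sat p e /\ sat q e.
Proof.
split=> [H|[hp hq] /= H]; last exact: H.
by split; apply: contrapT => h; apply: H => /= hp hq; apply: h.
Qed.

Lemma sat_for p q e : sat (for_ p q) e <-> sat p e \/ sat q e.
Proof.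
split=> [/= H|[hp /= h|hq /= _ //]]; last by case: (h hp).
by have [hp|hp] := EM (sat p e); [left|right; exact: H].
Qed.

Lemma sat_fex s (p : formula (ext V s)) e :
  sat (fex s p) e <-> exists a : M s, sat p (ext_asg e a).
Proof.
split=> [/= H|[a ha] /= H]; last exact: (H a).
by apply: contrapT => h; apply: H => a ha; apply: h; exists a.
Qed.

Definition fconj (ps : seq (formula V)) : formula V := foldr (@fand L V) ftop ps.

Lemma sat_fconj (I : eqType) (r : seq I) (phi : I -> formula V) e :
  sat (fconj (map phi r)) e <-> forall i, i \in r -> sat (phi i) e.
Proof.
elim: r => [|i r IH]; first by split=> [_ i|_ //]; rewrite in_nil.
rewrite -[fconj _]/(fand (phi i) (fconj (map phi r))) sat_fand IH; split=> [[h1 h2] j|h].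
  by rewrite inE => /predU1P[->|/h2].
by split=> [|j jr]; apply: h; rewrite inE ?eqxx ?jr ?orbT.
Qed.

Lemma sat_fconj_fin (I : finType) (phi : I -> formula V) e :
  sat (fconj (map phi (enum I))) e <-> forall i, sat (phi i) e.
Proof.
by rewrite sat_fconj; split=> h i => [|_]; [apply: h; rewrite mem_enum | exact: h].
Qed.

End connectives.

Lemma realizes_inst (L : language) (U : structure L) (V W : family L)
    (phi : formula (sum_fam V W)) (b : smap W U) (a : smap V U) :
  realizes a (inst phi b) <-> sat phi (copair a b).
Proof.
rewrite /realizes /inst sat_rename.
suff -> : fcomp (copair a (fid U)) (fun s v =>
    match v with inl x => inl x | inr y => inr (b s y) end) = copair a b by [].
by apply: smapP => s [].
Qed.

(** * One-variable types and the topology of type spaces *)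

Definition one_var (L : language) (s : lsort L) : family L :=
  tvar (fun _ : 'I_1 => s).

Definition one_asg (L : language) (M : family L) (s : lsort L) (a : M s) :
    smap (one_var s) M :=
  fun t v => match v in tvar _ t return M t with TVar _ => a end.

Lemma one_asgE (L : language) (M : family L) (s : lsort L)
    (e : smap (one_var s) M) : e = one_asg (e s (TVar _ ord0)).
Proof. by apply: smapP => t [i] /=; rewrite (ord1 i). Qed.

(** A finite part of [p] is a single formula over [U]. Its existential closure holds in [N],
    witnessed by [b], and elementarity brings it down to [U]. *)
Lemma elementary_finitely_sat (L : language) (U N : structure L)
    (f : smap U N) (A : subsets U) (s : lsort L) (b : N s)
    (p : set (formula (sum_fam (one_var s) (sub_fam A)))) :
  elementary f ->
  (forall phi, p phi -> sat phi (copair (one_asg b) (fcomp f (incl A)))) ->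
  finitely_sat p.
Proof.
move=> ef hb k phi pphi.
pose c : smap (sum_fam (one_var s) (sub_fam A)) (ext U s) := fun t v =>
  match v with
  | inl x => match x in tvar _ t return ext U s t with TVar _ => New end
  | inr y => Old (incl A t y)
  end.
pose psi : formula U := fex s (rename c (fconj (map phi (enum 'I_k)))).
have : sat psi f.
  apply/sat_fex; exists b; apply/sat_rename/sat_fconj_fin => i.
  suff -> : fcomp (ext_asg f b) c = copair (one_asg b) (fcomp f (incl A)).
    exact/hb/pphi.
  by apply: smapP => t [[]|].
move/ef => /sat_fex[a /sat_rename/sat_fconj_fin ha]; exists (one_asg a) => i.
suff <- : fcomp (ext_asg (fid U) a) c = copair (one_asg a) (incl A) by [].
by apply: smapP => t [[]|].
Qed.

Lemma nbhs_basic_clopen (L : language) (U : structure L) (A : subsets U)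
    (V : family L) (q : ctype A V) (B : set (ctype A V)) : nbhs q B ->
  exists k (chi : 'I_k -> formula (sum_fam V (sub_fam A))),
    (forall i, ctype_mem q (chi i)) /\
    forall r : ctype A V, (forall i, ctype_mem r (chi i)) -> B r.
Proof.
rewrite nbhsE => -[C [[D' sD <-] [E DE Eq]] sB].
have [X XD XE] := sD _ DE.
have /choice[g hg] : forall i : 'I_(size (finmap.enum_fset X)),
    exists phi, basic_clopen phi = nth set0 (finmap.enum_fset X) i.
  by move=> i; have /XD/set_mem[phi _ <-] : nth set0 (finmap.enum_fset X) i \in finmap.enum_fset X;
    [exact: mem_nth | exists phi].
exists _, g; split=> [i|r hr].
  change (basic_clopen (g i) q); rewrite hg.
  by move: Eq; rewrite -XE; apply => /=; exact: mem_nth.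
apply: sB; exists E => //; change (E r); rewrite -XE => F /= FX; change (F r).
have iF : (index F (finmap.enum_fset X) < size (finmap.enum_fset X))%N by rewrite index_mem.
by have := hr (Ordinal iF);
  rewrite -[ctype_mem _ _]/(basic_clopen _ _) hg /= nth_index.
Qed.

(** * Agreement of two matchings and extensions prescribing it *)

Section agreement.
Implicit Types M N : structure feq_lang.

Definition agree M (x : M sO) (z c : M sP) :=
  exists w, [/\ x <> w, interpE z x w & interpE c x w].

Definition fagree (V : family feq_lang) (x : V sO) (z c : V sP) : formula V :=
  @fex feq_lang V sO (fand (fnot (feq (Old x) New))
    (fand (fE (Old z) (Old x) New) (fE (Old c) (Old x) New))).

Lemma sat_fagree M (V : family feq_lang) (x : V sO) (z c : V sP)
    (e : smap V M) :
  sat (fagree x z c) e <-> agree (e sO x) (e sP z) (e sP c).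
Proof.
rewrite /fagree sat_fex; split=> -[w].
  by rewrite !sat_fand => -[? []]; exists w.
by case=> ? ? ?; exists w; rewrite !sat_fand.
Qed.

Lemma embedding_interpE M N (f : smap M N) (z : M sP) (x y : M sO) :
  embedding f -> interpE (f sP z) (f sO x) (f sO y) <-> interpE z x y.
Proof. by case=> _ /(_ rE (x, (y, (z, tt)))). Qed.

(** Classes have exactly two elements, so an embedding sends the partner of [x] to the partner of
    its image. Hence a witness found in [N] already comes from [M]. *)
Lemma agree_embedding M N (f : smap M N) (x : M sO) (z c : M sP) :
  models M Tfeq2 -> models N Tfeq2 -> embedding f ->
  agree (f sO x) (f sP z) (f sP c) <-> agree x z c.
Proof.
move=> /models_Tfeq2 MT /models_Tfeq2 NT ef; have [/(_ sO) fI _] := ef.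
split=> -[w [xw zw cw]]; last first.
  exists (f sO w); split; [by move=> /fI | |]; exact/embedding_interpE.
have [_ _ _ /(_ x)[y [yx Ey]]] := MT z.
have [_ _ _ /(_ (f sO x))[y' [yx' Ey']]] := NT (f sP z).
have fy : f sO y = y'.
  have /Ey'[/fI //|//] : interpE (f sP z) (f sO x) (f sO y).
  by apply/embedding_interpE => //; apply/Ey; right.
have wE : w = f sO y by case/Ey': zw => [xw'|->//]; case: xw.
exists y; split; [exact/nesym | by apply/Ey; right |].
by apply/(embedding_interpE _ _ _ ef); rewrite -wE.
Qed.

(* M embeds in a model N of Tfeq2 and N in a model N' of T; the second element *)
(* of a class, which exists in N and hence in N', descends to M because M is   *)
(* elementary in N'.                                                           *)
Lemma completion_models_Tfeq2 (T : theory feq_lang) M :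
  model_completion Tfeq2 T -> models M T -> models M Tfeq2.
Proof.
move=> [[emb emb' mc] _] MT.
have [N [f [/models_Tfeq2 NT ef]]] := emb' _ MT.
have [N' [g [NT' eg]]] := emb _ (proj2 (models_Tfeq2 N) NT).
have [fI _] := ef; have [gI _] := eg.
have egf : embedding (fcomp g f).
  split=> [s x y /gI /fI//|r a].
  by have [_ <-] := ef; have [_ <-] := eg; rewrite map_args_comp.
have elgf := mc _ _ _ MT NT' egf.
apply/models_Tfeq2 => z; have [Nr Ns Nt N2] := NT (f sP z).
split=> [x|x y|x y w|x].
- exact/(embedding_interpE _ _ _ ef).
- by move=> /(embedding_interpE _ _ _ ef)/Ns/(embedding_interpE _ _ _ ef).
- move=> /(embedding_interpE _ _ _ ef) xy /(embedding_interpE _ _ _ ef) yw.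
  by apply/(embedding_interpE _ _ _ ef); exact: Nt xy yw.
have [y' [yx' Ey']] := N2 (f sO x).
have [y [xy Exy]] : exists y, x <> y /\ interpE z x y.
  pose psi : formula M := @fex feq_lang M sO
    (fand (fnot (feq (Old x) New)) (fE (Old z) (Old x) New)).
  have /elgf/sat_fex[y /sat_fand[? ?]] : sat psi (fcomp g f); last by exists y.
  apply/sat_fex; exists (g sO y'); apply/sat_fand; split; first by move=> /gI/nesym.
  by apply/(embedding_interpE _ _ _ eg)/Ey'; right.
have fy : f sO y = y'.
  by move: Exy => /(embedding_interpE _ _ _ ef)/Ey'[/fI/nesym//|].
exists y; split=> [|w]; first exact/nesym.
rewrite -(embedding_interpE _ _ _ ef) Ey' -fy.
by split=> -[]; [move=> /fI; left|move=> /fI; right|move=> ->; left|move=> ->; right].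
Qed.

(* O(N) consists of two copies of O(M); the new matching follows c on S and   *)
(* swaps the copies elsewhere.                                                *)
Lemma extend_agree_O M (c : M sP) (S : set (M sO)) : models M Tfeq2 ->
  (forall x w, S x -> interpE c x w -> S w) ->
  exists N (f : smap M N) (z : N sP), [/\ models N Tfeq2, embedding f &
    forall x, agree (f sO x) z (f sP c) <-> S x].
Proof.
move=> /models_Tfeq2 MT Sc; have [cr cs ct c2] := MT c.
pose car (s : feq_sort) : Type :=
  match s with sO => (M sO * bool)%type | sP => option (M sP) end.
pose E (z : option (M sP)) (x y : M sO * bool) : Prop :=
  if z is Some d then x.2 = y.2 /\ interpE d x.1 y.1
  else (S x.1 /\ x.2 = y.2 /\ interpE c x.1 y.1) \/ (~ S x.1 /\ x.1 = y.1).
pose int (r : feq_rel) (a : @args feq_lang car [:: sO; sO; sP]) : Prop :=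
  E a.2.2.1 a.1 a.2.1.
have inh (s : lsort feq_lang) : inhabited (car s).
  case: s; first by have [a] := carrier_inhabited M sO; exact: inhabits (a, true).
  exact: inhabits None.
pose N := @Structure feq_lang car int inh.
pose f : smap M N := fun s => match s return M s -> N s with
  sO => fun x => (x, true) | sP => Some end.
exists N, f, None; split.
- apply/models_Tfeq2 => -[d|].
    have [dr ds dt d2] := MT d; split.
    + by move=> x; split.
    + by move=> x y [? /ds].
    + by move=> x y w [xy ?] [yw ?]; split; [rewrite xy|exact: dt (y.1) _ _ _].
    + move=> [x i]; have [y [yx Ey]] := d2 x; exists (y, i); split; first by case.
      move=> [w j]; split=> [[/= -> /Ey[->|->]]|]; [by left|by right|].
      by case=> -[-> ->]; split=> //=; apply/Ey; auto.
  split.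
  + by move=> x; have [Sx|Sx] := EM (S x.1); [left|right].
  + move=> x y [[Sx [xy cxy]]|[Sx xy]]; [left|right].
      by split; [exact: Sc cxy | split=> //; exact: cs].
    by rewrite -xy.
  + move=> x y w [[Sx [xy cxy]]|[Sx xy]] [[Sy [yw cyw]]|[Sy yw]].
    * by left; split=> //; split; [rewrite xy | exact: ct cyw].
    * by case: Sy; exact: Sc cxy.
    * by case: Sx; rewrite xy.
    * by right; rewrite xy.
  + move=> [x i]; have [Sx|Sx] := EM (S x).
      have [y [yx Ey]] := c2 x; exists (y, i); split; first by case.
      move=> [w j]; split=> [[[/= _ [-> /Ey[->|->]]]|[]//]|]; [by left|by right|].
      by case=> -[-> ->]; left; split=> //; split=> //=; apply/Ey; auto.
    exists (x, ~~ i); split; first by case=> /esym; case: (i).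
    move=> [w j]; split=> [[[//]|[/= _ ->]]|].
      by case: i j => -[]; auto.
    by case=> -[-> _]; right.
- split=> [[] x y /= []//|[] [x [y [z []]]] /=].
  by split=> [[]|].
- move=> x; split=> [[[w j] [xw Ew [/= ij cw]]]|Sx].
    (* Off [S] the new matching preserves the point of [M] and [c] preserves the copy, so [w] would
       be the point itself. *)
    by case: Ew => /= [[]//|[_ xw']]; case: xw; rewrite [x in LHS]xw' -ij.
  have [y [yx Ey]] := c2 x; have cxy : interpE c x y by apply/Ey; right.
  by exists (y, true); split; [case=> /esym | left | split].
Qed.

(* O(N) adds a square to O(M); the matchings in S pair its points along one   *)
(* direction, the others along the other.                                     *)
Lemma extend_agree_P M (c : M sP) (S : set (M sP)) : models M Tfeq2 -> S c ->
  exists N (f : smap M N) (x : N sO), [/\ models N Tfeq2, embedding f &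
    forall z, agree x (f sP z) (f sP c) <-> S z].
Proof.
move=> /models_Tfeq2 MT Sc.
pose car (s : feq_sort) : Type :=
  match s with sO => (M sO + bool * bool)%type | sP => M sP end.
pose E (z : M sP) (x y : M sO + bool * bool) : Prop :=
  match x, y with
  | inl x, inl y => interpE z x y
  | inr x, inr y => S z /\ x.2 = y.2 \/ ~ S z /\ x.1 = y.1
  | _, _ => False
  end.
pose int (r : feq_rel) (a : @args feq_lang car [:: sO; sO; sP]) : Prop :=
  E a.2.2.1 a.1 a.2.1.
have inh (s : lsort feq_lang) : inhabited (car s).
  by case: s; [exact: inhabits (inr (true, true)) | exact: carrier_inhabited M sP].
pose N := @Structure feq_lang car int inh.
pose f : smap M N := fun s => match s return M s -> N s with
  sO => inl | sP => id end.
exists N, f, (inr (true, true)); split.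
- apply/models_Tfeq2 => z; have [zr zs zt z2] := MT z; split.
  + by move=> [x|x]; [exact: zr | have [] := EM (S z); [left|right]].
  + move=> [x|x] [y|y] //; first exact: zs.
    by case=> -[? ?]; [left|right].
  + move=> [x|x] [y|y] [w|w] //; first exact: zt.
    by case=> -[Sz xy] [] [Sz' yw] //; [left|right]; rewrite xy.
  + move=> [x|[i j]].
      have [y [yx Ey]] := z2 x; exists (inl y); split; first by case.
      move=> [w|w]; last by split=> [[]|[]].
      by split=> [/Ey[->|->]|[[->]|[->]]]; [left|right|apply/Ey; left|apply/Ey; right].
    have [Sz|Sz] := EM (S z).
      exists (inr (~~ i, j)); split; first by case; case: (i).
      move=> [w|[i' j']]; first by split=> [[]|[]].
      split=> [[[_ /= <-]|[]//]|]; first by case: i i' => -[]; auto.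
      by case=> -[_ ->]; left.
    exists (inr (i, ~~ j)); split; first by case; case: (j).
    move=> [w|[i' j']]; first by split=> [[]|[]].
    split=> [[[]//|[_ /= <-]]|]; first by case: j j' => -[]; auto.
    by case=> -[-> _]; right.
- by split=> [[] x y //= []//|[] [x [y [z []]]] /=].
- move=> z; split=> [[[w|[i j]] [xw Ez Ec]]//|Sz].
    case: Ec => -[] // _ /= jE; case: Ez => -[//] _ /= iE.
    by case: xw; rewrite -iE -jE.
  by exists (inr (false, true)); split=> //; left.
Qed.

End agreement.

(** * Agreement for both sorts at once, and its realization in the monster *)

Definition other_sort (s : feq_sort) : feq_sort :=
  match s with sO => sP | sP => sO end.

Definition sagree (M : structure feq_lang) (s : feq_sort) :
    M s -> M (other_sort s) -> M sP -> Prop :=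
  match s with
  | sO => fun x z c => agree x z c
  | sP => fun z x c => agree x z c
  end.

Definition fsagree (V : family feq_lang) (s : feq_sort) :
    V s -> V (other_sort s) -> V sP -> formula V :=
  match s with
  | sO => fun x z c => fagree x z c
  | sP => fun z x c => fagree x z c
  end.

Lemma sat_fsagree (M : structure feq_lang) (V : family feq_lang) s
    (x : V s) (y : V (other_sort s)) (c : V sP) (e : smap V M) :
  sat (fsagree x y c) e <-> sagree (e s x) (e _ y) (e sP c).
Proof. by case: s x y => x y; exact: sat_fagree. Qed.

Lemma sagree_embedding (M N : structure feq_lang) (f : smap M N) s
    (x : M s) (y : M (other_sort s)) (c : M sP) :
  models M Tfeq2 -> models N Tfeq2 -> embedding f ->
  sagree (f s x) (f _ y) (f sP c) <-> sagree x y c.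
Proof. by case: s x y => x y; exact: agree_embedding. Qed.

Lemma extend_sagree (M : structure feq_lang) s (c : M sP) (I : finType)
    (a : I -> M s) : models M Tfeq2 ->
  exists (J : finType) (g : J -> M s) (N : structure feq_lang) (f : smap M N)
    (y : N (other_sort s)),
    [/\ models N Tfeq2, embedding f, forall i, sagree (f s (a i)) y (f sP c) &
      forall x, sagree (f s x) y (f sP c) -> exists j, g j = x].
Proof.
move=> MT; case: s a => a.
  have [cr cs ct c2] := proj1 (models_Tfeq2 M) MT c.
  (* Agreement with [c] is a property of whole [E_c]-classes, so the partners [h i] come along and
     the list doubles. *)
  pose S : set (M sO) := [set x | exists i, interpE c (a i) x].
  have Sc x w : S x -> interpE c x w -> S w.
    by move=> [i ax] xw; exists i; exact: ct xw.
  have [N [f [z [NT ef fS]]]] := extend_agree_O MT Sc.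
  have [h hP] := choice (fun i => c2 (a i)).
  exists ('I_2 * I)%type, (fun j => if j.1 == ord0 then a j.2 else h j.2).
  exists N, f, z; split=> // [i|x /fS[i] /(proj2 (hP i))[->|->]].
  - by apply/fS; exists i.
  - by exists (ord0, i).
  - by exists (ord_max, i).
(* As [c] agrees with itself everywhere, it has to be listed too; [None] stands for it. *)
have [||N [f [x [NT ef fS]]]] := @extend_agree_P M c
    [set z | z = c \/ exists i, a i = z] => //; first by left.
exists (option I), (fun j => if j is Some i then a i else c), N, f, x.
split=> // [i|z /fS[->|[i <-]]]; first by apply/fS; right; exists i.
  by exists None.
by exists (Some i).
Qed.

(** The extension given by [extend_sagree] embeds in a model of [T], which is elementary over [U] by
    model completeness. The agreements and disagreements of its new element with the points of [A]
    form a finitely satisfiable type, which saturation realizes in [U]. *)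
Lemma saturated_sagree (K : Type) (T : theory feq_lang)
    (U : structure feq_lang) (A : subsets U) s (c : sub_fam A sP)
    (I : finType) (a : I -> sub_fam A s) :
  model_completion Tfeq2 T -> models U T -> saturated K U -> small K A ->
  exists (J : finType) (g : J -> U s) (y : U (other_sort s)),
    (forall i, sagree (sval (a i)) y (sval c)) /\
    forall x : sub_fam A s, sagree (sval x) y (sval c) ->
      exists j, g j = sval x.
Proof.
move=> hT UT satU sA; have UTf := completion_models_Tfeq2 hT UT.
have [J [g [N [f [y [NT ef ay yg]]]]]] :=
  extend_sagree (sval c) (fun i => sval (a i)) UTf.
have [[emb _ mc] _] := hT; have [N' [h [NT' eh]]] := emb _ NT.
have NTf' := completion_models_Tfeq2 hT NT'.
have ehf : embedding (fcomp h f).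
  have [fI fr] := ef; have [hI hr] := eh.
  split=> [t u v /hI /fI//|r b].
  by rewrite -(map_args_comp f h) hr fr.
pose ag (x : sub_fam A s) : formula (sum_fam (one_var (L := feq_lang)
    (other_sort s)) (sub_fam A)) :=
  @fsagree (sum_fam (one_var (L := feq_lang) (other_sort s)) (sub_fam A)) s
    (inr x) (inl (TVar _ ord0)) (inr c).
pose p := [set phi | (exists i, phi = ag (a i)) \/
  exists2 x, ~ (exists j, g j = sval x) & phi = fnot (ag x)].
have agE x : sat (ag x) (copair (one_asg (h _ y)) (fcomp (fcomp h f) (incl A)))
    <-> sagree (f s (sval x)) y (f sP (sval c)).
  by rewrite sat_fsagree; exact: (sagree_embedding (f := h) (f s (sval x)) y (f sP (sval c)) NT NTf' eh).
have [] := satU _ _ A p sA.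
  apply: (elementary_finitely_sat (b := h _ y) (mc _ _ _ UT NT' ehf)).
  by move=> phi [[i ->]|[x xg ->]]; [exact/agE | move=> /agE/yg].
move=> b bp; exists J, g, (b _ (TVar _ ord0)); split=> [i|x xy].
  by have /bp/sat_fsagree : p (ag (a i)) by left; exists i.
apply: contrapT => xg; have /bp : p (fnot (ag x)) by right; exists x.
by apply; apply/sat_fsagree.
Qed.

(** * Elementary properties of Keisler measures *)

Section keisler_measure_theory.
Variables (R : realType) (L : language) (U : structure L) (V : family L).
Variable mu : keisler_measure R U V.
Implicit Types phi psi : formula (sum_fam V U).

Lemma kmeas_split phi psi :
  mu phi = mu (fand phi psi) + mu (fand phi (fnot psi)).
Proof.
rewrite -kmeas_add => [|a]; last first.
  by rewrite /realizes !sat_fand => -[[_ ?] [_ /sat_fnot]].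
apply: kmeas_equiv => a; rewrite /realizes sat_for !sat_fand sat_fnot.
by have [] := EM (sat psi (copair a (fid U))); tauto.
Qed.

Lemma kmeas_bot phi : (forall a, ~ realizes a phi) -> mu phi = 0.
Proof.
move=> h; have := @kmeas_add _ _ _ _ mu phi phi (fun a => fun H => h a H.1).
rewrite (@kmeas_equiv _ _ _ _ mu (for_ phi phi) phi) => [/eqP|a].
  by rewrite -subr_eq0 opprD addrA subrr sub0r oppr_eq0 => /eqP.
by rewrite /realizes sat_for; tauto.
Qed.

(** Finite satisfiability only controls points of the small model, so it yields inclusions up to
    null sets. *)
Lemma kmeas_le_null phi psi : mu (fand phi (fnot psi)) = 0 -> mu phi <= mu psi.
Proof.
move=> h0; rewrite (kmeas_split phi psi) h0 addr0 (kmeas_split psi phi).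
rewrite (@kmeas_equiv _ _ _ _ mu (fand psi phi) (fand phi psi)).
  by rewrite lerDl kmeas_ge0.
by move=> a; rewrite /realizes !sat_fand; tauto.
Qed.

Lemma kmeas_le phi psi :
  (forall a, realizes a phi -> realizes a psi) -> mu phi <= mu psi.
Proof.
move=> h; apply/kmeas_le_null/kmeas_bot => a.
by rewrite /realizes sat_fand => -[/h ? /sat_fnot].
Qed.

Lemma kmeas_fnot phi : mu (fnot phi) = 1 - mu phi.
Proof.
apply/eqP; rewrite eq_sym subr_eq -(kmeas_top mu) (kmeas_split ftop phi) addrC.
by apply/eqP; congr (_ + _); apply: kmeas_equiv => a;
  rewrite /realizes sat_fand; split=> [[]|h] //; split.
Qed.

Lemma kmeas_le1 phi : mu phi <= 1.
Proof. by rewrite -subr_ge0 -kmeas_fnot kmeas_ge0. Qed.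

Lemma kmeas_fconj (I : Type) (r : seq I) (phi : I -> formula (sum_fam V U)) :
  1 - mu (fconj (map phi r)) <= \sum_(i <- r) (1 - mu (phi i)).
Proof.
elim: r => [|i r IH]; first by rewrite big_nil /= kmeas_top subrr.
rewrite big_cons -[fconj _]/(fand (phi i) (fconj (map phi r))).
apply: le_trans (lerD (lexx _) IH).
rewrite -!kmeas_fnot (kmeas_split (fnot (fand _ _)) (fnot (phi i))).
by apply: lerD; apply: kmeas_le => a;
  rewrite /realizes !(sat_fand, sat_fnot); tauto.
Qed.

End keisler_measure_theory.

Definition fmem (L : language) (U : structure L) (V : family L) s (v : V s)
    (J : finType) (g : J -> U s) : formula (sum_fam V U) :=
  fnot (fconj [seq fnot (@feq L (sum_fam V U) s (inl v) (inr (g j))) | j <- enum J]).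

Lemma realizes_fmem (L : language) (U : structure L) (V : family L) s (v : V s)
    (J : finType) (g : J -> U s) (a : smap V U) :
  realizes a (fmem v g) <-> exists j, a s v = g j.
Proof.
rewrite /realizes sat_fnot sat_fconj_fin; split=> [h|[j gj] /(_ j)]; last exact.
by apply: contrapT => nex; apply: h => j gj; apply: nex; exists j.
Qed.

(** Definability concerns formulas without parameters, so [c] has to be carried next to [y] in the
    parameter tuple. *)
Definition pair_sort (L : language) (s0 s1 : lsort L) (j : 'I_2) : lsort L :=
  if val j == 0%N then s0 else s1.

Definition pair_asg (L : language) (M : family L) (s0 s1 : lsort L)
    (a : M s0) (b : M s1) : smap (tvar (pair_sort s0 s1)) M :=
  fun t v => match v in tvar _ t return M t with
    TVar j => if val j == 0%N as z return M (if z then s0 else s1)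
              then a else b end.

Lemma fcomp_pair_asg (L : language) (M N : family L) (s0 s1 : lsort L)
    (a : M s0) (b : M s1) (f : smap M N) :
  fcomp f (pair_asg a b) = pair_asg (f _ a) (f _ b).
Proof. by apply: smapP => t [[[|j] hj]]. Qed.

(** * Concentration of one coordinate on a finite set *)

Section coordinate.
Variables (R : realType) (K : Type) (T : theory feq_lang).
Variables (U : structure feq_lang) (V : family feq_lang).
Variables (mu : keisler_measure R U V) (A : subsets U).
Hypotheses (hT : model_completion Tfeq2 T) (UT : models U T).
Hypotheses (satU : saturated K U) (sA : small K A).
Hypotheses (defA : definable_over A mu) (finA : finitely_satisfiable_in A mu).
Variables (s : feq_sort) (v : V s) (c : sub_fam A sP) (a0 : sub_fam A s).

Let phi : formula (sum_fam V (tvar (pair_sort (L := feq_lang) (other_sort s) sP))) :=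
  @fsagree (sum_fam V (tvar (pair_sort (L := feq_lang) (other_sort s) sP))) s
    (inl v) (inr (TVar _ ord0)) (inr (TVar _ ord_max)).

Let phi_at (y : U (other_sort s)) : formula (sum_fam V U) :=
  inst phi (pair_asg (L := feq_lang) y (sval c)).

Let realizes_phi_at y b : realizes b (phi_at y) <-> sagree (b s v) y (sval c).
Proof. by rewrite realizes_inst; exact: sat_fsagree. Qed.

(* Otherwise saturation would give a y with phi(a, y) for all a in A but with *)
(* tp(y, c / A) in the closure of the types where phi has measure <= 1 - e.   *)
Lemma finitely_many_agreements (e : R) : 0 < e ->
  exists k (a : 'I_k -> sub_fam A s), forall y,
    (forall j, sagree (sval (a j)) y (sval c)) -> 1 - e < mu (phi_at y).
Proof.
move=> e0; apply: contrapT => H; have [_ /(_ _ _ phi)[F [Fc FE]]] := defA.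
pose one := one_var (L := feq_lang) (other_sort s).
pose y0 : one (other_sort s) := TVar _ ord0.
pose ag (x : sub_fam A s) : formula (sum_fam one (sub_fam A)) :=
  @fsagree (sum_fam one (sub_fam A)) s (inr x) (inl y0) (inr c).
pose p : set (formula (sum_fam one (sub_fam A))) := [set psi |
  (exists x, psi = ag x) \/
  forall y, ~ (1 - e < mu (phi_at y)) -> sat psi (copair (one_asg y) (incl A))].
have fsp : finitely_sat p.
  move=> k psi ppsi.
  (* Formulas of the second kind get the dummy point [a0], which merely adds a requirement on
     [y]. *)
  have /choice[a ha] : forall i, exists x, psi i = ag x \/
      forall y, ~ (1 - e < mu (phi_at y)) ->
        sat (psi i) (copair (one_asg y) (incl A)).
    by move=> i; case: (ppsi i) => [[x ->]|h]; [exists x; left|exists a0; right].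
  apply: contrapT => nsat; apply: H; exists k, a => y ay.
  apply: contrapT => ny; apply: nsat; exists (one_asg y) => i.
  by case: (ha i) => [->|/(_ y ny)//]; apply/sat_fsagree; exact: ay.
have [b bp] := satU sA fsp; pose y := b _ y0.
have bE : b = one_asg y by exact: one_asgE.
have agy (x : sub_fam A s) : sagree (sval x) y (sval c).
  by have /bp/sat_fsagree : p (ag x) by left; exists x.
(* A negation of positive measure would be realized in [A], where [y] agrees at every point. *)
have mu1 : mu (phi_at y) = 1.
  apply/eqP; rewrite eq_sym -subr_eq0 -kmeas_fnot eq_le kmeas_ge0 andbT leNgt.
  by apply/negP => /finA[d]; apply; apply/realizes_phi_at/agy.
pose yc (z : U (other_sort s)) := pair_asg (L := feq_lang) z (sval c).
have /nbhs_basic_clopen[k [chi [chiy chiF]]] :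
    nbhs (tp A (yc y)) [set r | 1 - e < F r].
  apply: (Fc (tp A (yc y)) [set z | 1 - e < z]); apply: lt_nbhsr.
  by rewrite FE mu1 ltrBlDr ltrDl.
(* Since [c] lies in [A], a formula over [A] about the pair is one about [y] alone. *)
pose sub : smap (sum_fam (tvar (pair_sort (L := feq_lang) (other_sort s) sP))
    (sub_fam A)) (sum_fam one (sub_fam A)) :=
  copair (@pair_asg feq_lang (sum_fam one (sub_fam A)) (other_sort s) sP
    (inl y0) (inr c)) (fun t x => inr x).
have subE z : fcomp (copair (one_asg z) (incl A)) sub = copair (yc z) (incl A).
  apply: smapP => t [x|//].
  by have /(congr1 (fun f => f t x)) := fcomp_pair_asg (L := feq_lang)
    (M := sum_fam one (sub_fam A)) (s0 := other_sort s) (s1 := sP) (inl y0) (inr c)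
    (copair (one_asg z) (incl A)).
(* Every [z] of measure at most [1 - e] misses the neighbourhood, so [p] demands that [y] miss it as
   well. *)
have : p (rename sub (fnot (fconj [seq chi i | i <- enum 'I_k]))).
  right=> z zF; apply/sat_rename; rewrite subE => /sat_fconj_fin zchi.
  apply: zF; rewrite -FE; exact: chiF.
move=> /bp /sat_rename; rewrite bE subE; apply; exact/sat_fconj_fin.
Qed.

Lemma coordinate_concentrated (e : R) : 0 < e ->
  exists m (g : nat -> U s), 1 - e < mu (fmem v (fun j : 'I_m => g j)).
Proof.
move=> /finitely_many_agreements[k [a ha]].
have [J [g [y [ay yg]]]] := saturated_sagree c a hT UT satU sA.
(* The list becomes a sequence on [nat], so that coordinates can later be indexed uniformly; [a0]
   fills the values past its end. *)
exists #|J|, (fun j => if insub j is Some i then g (enum_val (i : 'I_#|J|)) else sval a0).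
apply: (lt_le_trans (ha y ay)); apply/kmeas_le_null/eqP.
rewrite eq_le kmeas_ge0 andbT leNgt; apply/negP => /finA[d].
rewrite /realizes sat_fand => -[/realizes_phi_at/yg[j gj]].
by apply; apply/realizes_fmem; exists (enum_rank j); rewrite valK enum_rankK.
Qed.

End coordinate.

(** * From concentration on finite sets to a series of point masses *)

Section enumerated_tuples.
Variables (R : realType) (L : language) (U : structure L).
Variables (n : nat) (sigma : 'I_n -> lsort L).
Variables (mu : keisler_measure R U (tvar sigma)).
Variable a : nat -> smap (tvar sigma) U.

Definition ftuple (b : smap (tvar sigma) U) : formula (sum_fam (tvar sigma) U) :=
  fconj [seq @feq L (sum_fam (tvar sigma) U) _ (inl (TVar sigma i))
               (inr (b _ (TVar sigma i))) | i <- enum 'I_n].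

Lemma realizes_ftuple b d : realizes d (ftuple b) <-> d = b.
Proof.
rewrite /realizes sat_fconj_fin; split=> [h|-> //].
by apply: smapP => s [i]; exact: h.
Qed.

Definition finitial (N : nat) : formula (sum_fam (tvar sigma) U) :=
  fnot (fconj [seq fnot (ftuple (a (i : 'I_N))) | i <- enum 'I_N]).

Lemma realizes_finitial N d :
  realizes d (finitial N) <-> exists2 k, (k < N)%N & d = a k.
Proof.
rewrite /realizes sat_fnot sat_fconj_fin; split=> [h|[k kN dk] /(_ (Ordinal kN))].
  apply: contrapT => nex; apply: h => k dk; apply: nex.
  by exists k => //; exact/realizes_ftuple.
by apply; exact/realizes_ftuple.
Qed.

(* the measure of the point a N if it is not repeated earlier, and 0 otherwise *)
Let weight N : R := mu (fand (ftuple (a N)) (fnot (finitial N))).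

(** The sum telescopes: passing from [N] to [N.+1] adds the point [a N] if it is new, and this
    counts exactly when it satisfies [phi]. *)
Lemma series_weight N phi :
  series (fun k => weight k * dirac_kmeas R (a k) phi) N =
  mu (fand phi (finitial N)).
Proof.
rewrite /series /=; elim: N => [|N IH].
  rewrite big_geq // kmeas_bot // => d.
  by rewrite /realizes sat_fand => -[_ /realizes_finitial[]].
rewrite big_nat_recr //= IH (kmeas_split mu (fand _ (finitial N.+1)) (finitial N)).
have finS d : realizes d (finitial N.+1) <-> realizes d (finitial N) \/ d = a N.
  rewrite !realizes_finitial; split=> [[k]|[[k kN ->]|->]].
  - by rewrite ltnS leq_eqVlt => /predU1P[->|kN] ->; [right|left; exists k].
  - by exists k => //; exact: leqW.
  - by exists N.
congr (_ + _).
  apply: kmeas_equiv => d; move: (finS d).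
  by rewrite /realizes !sat_fand; tauto.
rewrite /dirac_kmeas /weight; case: asboolP => [aN|naN].
  rewrite mulr1; apply: kmeas_equiv => d; move: (finS d) (realizes_ftuple (a N) d).
  rewrite /realizes !(sat_fand, sat_fnot) => fS dN.
  split=> [[/dN dE ?]|]; last by tauto.
  by split=> //; split; [rewrite dE|apply/fS; right].
rewrite mulr0 kmeas_bot // => d; move: (finS d).
rewrite /realizes !(sat_fand, sat_fnot) => fS [[dphi /fS[//|dN]] _].
by apply: naN; rewrite -dN.
Qed.

Lemma trivial_kmeas_enum :
  (forall e, 0 < e -> exists N, 1 - e < mu (finitial N)) -> trivial_kmeas mu.
Proof.
move=> conc; have cvg phi :
    series (fun k => weight k * dirac_kmeas R (a k) phi) @ \oo --> mu phi.
  apply/cvgrPdist_lt => e e0; have [N0 hN0] := conc e e0.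
  exists N0 => // N /= N0N.
  rewrite series_weight (kmeas_split mu phi (finitial N)) addrC addKr.
  rewrite ger0_norm ?kmeas_ge0 //.
  (* The error is the part of [phi] outside the first [N] points, hence outside the first [N0]. *)
  apply: (@le_lt_trans _ _ (1 - mu (finitial N0))); last by rewrite ltrBlDl -ltrBlDr.
  rewrite -kmeas_fnot; apply: kmeas_le => d.
  rewrite /realizes sat_fand !sat_fnot => -[_ h] /realizes_finitial[k kN dk].
  by apply: h; apply/realizes_finitial; exists k => //; exact: leq_trans N0N.
exists weight, a; split=> //; first by move=> k; rewrite kmeas_ge0 kmeas_le1.
have := cvg ftop; rewrite kmeas_top.
suff -> : (fun k => weight k * dirac_kmeas R (a k) ftop) = weight by [].
apply/funext => k; rewrite /dirac_kmeas asboolT ?mulr1 //; exact: sat_ftop.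
Qed.

End enumerated_tuples.

(** A product of finite lists is finite, and by the union bound it carries all but the sum of the
    coordinate errors. A single enumeration has to serve all errors, so it runs through pairs of a
    precision [k] and a choice of list positions. *)
Lemma trivial_kmeas_coordinates (R : realType) (L : language) (U : structure L)
    (n : nat) (sigma : 'I_n -> lsort L) (mu : keisler_measure R U (tvar sigma)) :
  (forall i (e : R), 0 < e -> exists m (g : nat -> U (sigma i)),
     1 - e < mu (fmem (TVar sigma i) (fun j : 'I_m => g j))) ->
  trivial_kmeas mu.
Proof.
(* The [n] coordinate errors add up to at most [1 / (k + 1)]; dividing by [n.+1] also covers the
   empty tuple. *)
move=> conc; pose eps (k : nat) : R := k.+1%:R^-1 / n.+1%:R.
have eps0 k : 0 < eps k by rewrite divr_gt0 ?invr_gt0 ?ltr0n.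
have conc' k i : exists p : nat * (nat -> U (sigma i)),
    1 - eps k < mu (fmem (TVar sigma i) (fun j : 'I_(p.1) => p.2 j)).
  by have [m [g h]] := conc i _ (eps0 k); exists (m, g).
pose p k i := projT1 (cid (conc' k i)).
have pP k i := projT2 (cid (conc' k i)).
pose pt (q : nat * {ffun 'I_n -> nat}) : smap (tvar sigma) U := fun t v =>
  match v in tvar _ t return U t with TVar i => (p q.1 i).2 (q.2 i) end.
pose a N := pt (odflt (0%N, [ffun=> 0%N]) (unpickle N)).
apply: (trivial_kmeas_enum (a := a)) => e e0.
have [k] := ltr_add_invr e0; rewrite add0r => ke.
(* A common bound on the list lengths makes the positions in the box a finite type, whose codes have
   a maximum. *)
pose M := \max_(i < n) (p k i).1.
pose code (h : {ffun 'I_n -> 'I_M}) : nat := pickle (k, [ffun i => h i : nat]).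
exists (\max_h code h).+1.
pose box := fconj [seq fmem (TVar sigma i) (fun j : 'I_(p k i).1 => (p k i).2 j)
                  | i <- enum 'I_n].
have boxe : 1 - mu box < e.
  apply: le_lt_trans (kmeas_fconj _ _ _) _; apply: le_lt_trans ke.
  apply: (@le_trans _ _ (\sum_(i <- enum 'I_n) eps k)).
    by apply: ler_sum => i _; rewrite lerBlDl -lerBlDr ltW // pP.
  rewrite big_enum sumr_const card_ord -[eps k *+ n]mulr_natr -[eps k * _]mulrA.
  apply: ler_piMr; first by rewrite invr_ge0.
  by rewrite mulrC ler_pdivrMr ?ltr0n // mul1r ler_nat.
apply: (@lt_le_trans _ _ (mu box)); first by rewrite ltrBlDl -ltrBlDr.
apply: kmeas_le => d /sat_fconj_fin dbox; apply/realizes_finitial.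
have /choice[h hP] : forall i, exists j : 'I_M, d _ (TVar sigma i) = (p k i).2 j.
  move=> i; have [j dj] := proj1 (realizes_fmem _ _ d) (dbox i).
  have jM : (j < M)%N by apply: leq_trans (leq_bigmax i).
  by exists (Ordinal jM).
exists (code (finfun h)); first by rewrite ltnS; exact: leq_bigmax.
apply: smapP => t [i]; rewrite /a pickleK /= !ffunE; exact: hP.
Qed.

Theorem theorem8p5 (R : realType) (Tfeq2star : theory feq_lang)
    (hcompletion : model_completion Tfeq2 Tfeq2star) :
  dfs_trivial R Tfeq2star.
Proof.
move=> K U [_ UT satU _] n sigma mu [A [[A0 _] sA defA finA]].
apply: trivial_kmeas_coordinates => i e e0.
have [c cA] := A0 sP; have [a aA] := A0 (sigma i).
apply: (coordinate_concentrated (K := K) (T := Tfeq2star) (A := A)) => //.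
- exact: exist _ c cA.
- exact: exist _ a aA.
Qed.
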